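(* Let $H$ be a finite-dimensional Hopf algebra over a field $\mathbb{K}\in\{\mathbb{R},\mathbb{C}\}$ with counit $\epsilon$, let $L\subseteq H$ be a subalgebra (not necessarily a Hopf subalgebra), and let $(V,\triangleright,L)$ be a finite-dimensional left $L$-module. Let $(V^\uparrow,\triangleright,H)$ be the (co)induced $H$-module, with carrier space $V^\uparrow=\mathrm{Hom}_L(H,V)$ regarded as a subspace of $V\otimes H^*$. Then $(V^\uparrow,\triangleright,H)$ is an $H$-submodule of the tensor product module $(V,\triangleright,H)\otimes(H^*,\triangleright,H)$, where the second factor is the left regular $H$-co-space and the action of $H$ on the first factor is given by the counit: $$h\triangleright v=\epsilon(h)\,v,\qquad h\in H,\ v\in V.$$
   Context: Coinduced module: $\mathrm{Hom}_L(H,V)$ is the space of $\mathbb{K}$-linear maps $F:H\to V$ with $F(lh)=l\triangleright F(h)$ for all $l\in L$, $h\in H$, where $\triangleright$ here is the given $L$-action on $V$. The left action of $H$ on it is $(h\triangleright F)(h')=F(h'h)$ for $h,h'\in H$. Since $H$ and $V$ are finite-dimensional, $\mathrm{Hom}_{\mathbb{K}}(H,V)$ is identified with $V\otimes H^*$, where $\sum_i v_i\otimes\varphi_i$ corresponds to $h\mapsto\sum_i\langle\varphi_i,h\rangle v_i$. Under this identification $V^\uparrow$ is the subspace of those $\sum_i v_i\otimes\varphi_i$ such that $\sum_i\langle\varphi_i,lh\rangle v_i=\sum_i\langle\varphi_i,h\rangle(l\triangleright v_i)$ for all $h\in H$, $l\in L$. Left regular $H$-co-space $(H^*,\triangleright,H)$: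 $h\triangleright\varphi=\langle h,\varphi_{(2)}\rangle\varphi_{(1)}$ for $h\in H$, $\varphi\in H^*$, where $\varphi_{(1)}\otimes\varphi_{(2)}$ is the coproduct of $H^*$ dual to the product of $H$; equivalently $\langle h\triangleright\varphi,h'\rangle=\langle\varphi,h'h\rangle$. Tensor product of left $H$-modules: $h\triangleright(v\otimes\varphi)=(h_{(1)}\triangleright v)\otimes(h_{(2)}\triangleright\varphi)$, with $\Delta(h)=h_{(1)}\otimes h_{(2)}$ (Sweedler notation, summation understood). *)

(* Defs.v *)
From HB Require Import structures.
From mathcomp Require Import all_boot all_algebra falgebra.
From mathcomp Require Import reals.
From mathcomp Require Import complex.

Set Implicit Arguments.
Unset Strict Implicit.
Unset Printing Implicit Defensive.

Import GRing.Theory.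
Local Open Scope ring_scope.

Section Tensor.
Variable K : fieldType.
Implicit Types U V W : vectType K.

(* A model of V ⊗ W: coordinate matrices with respect to the library's chosen
   bases of V and W. Everything below uses it only through [tmul] and
   [tlift]; [tmul_bilinear], [tlift_tmul] and [tens_ind] (the pure tensors
   span) together are its universal property. *)
Definition tens V W := 'M[K]_(\dim {:V}, \dim {:W}).
HB.instance Definition _ V W := Vector.on (tens V W).

Definition tmul V W (v : V) (w : W) : tens V W :=
  \matrix_(i, j) (coord (vbasis {:V}) i v * coord (vbasis {:W}) j w).

(* The linear map V ⊗ W -> U induced by a bilinear f; that is, the value of
   the Sweedler-style sum of the f t_(1) t_(2), for t = t_(1) ⊗ t_(2). *)
Definition tlift V W U (f : V -> W -> U) (t : tens V W) : U :=
  \sum_i \sum_j t i j *: f (vbasis {:V})`_i (vbasis {:W})`_j.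

Lemma tlift_is_linear V W U (f : V -> W -> U) : linear (tlift f).
Proof.
move=> k s t; rewrite /tlift scaler_sumr -big_split; apply: eq_bigr => i _.
rewrite scaler_sumr -big_split; apply: eq_bigr => j _.
by rewrite !mxE scalerDl scalerA.
Qed.
HB.instance Definition _ V W U (f : V -> W -> U) :=
  GRing.isLinear.Build K (tens V W) U *:%R (tlift f) (tlift_is_linear f).

Lemma tmul_bilinear V W : bilinear_for *:%R *:%R (@tmul V W).
Proof.
by split=> u k x y; apply/matrixP => i j; rewrite !mxE linearP /=;
  rewrite ?mulrDl ?mulrDr -?mulrA // [in X in X + _]mulrCA.
Qed.

Lemma coord_sum V (v : V) :
  v = \sum_i coord (vbasis {:V}) i v *: (vbasis {:V})`_i.
Proof. exact: coord_vbasis (memvf v). Qed.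

Lemma tlift_tmul V W U (f : V -> W -> U) v w :
  bilinear_for *:%R *:%R f -> tlift f (tmul v w) = f v w.
Proof.
move=> [fl fr].
have sumr u (I : finType) (c : I -> K) (x : I -> W) :
  f u (\sum_i c i *: x i) = \sum_i c i *: f u (x i).
  pose g : {linear W -> U} := HB.pack (f u) (GRing.isLinear.Build _ _ _ _ _ (fr u)).
  rewrite -[LHS]/(g _) linear_sum; apply: eq_bigr => i _.
  by rewrite linearZ.
have suml u (I : finType) (c : I -> K) (x : I -> V) :
  f (\sum_i c i *: x i) u = \sum_i c i *: f (x i) u.
  pose g : {linear V -> U} := HB.pack (f^~ u) (GRing.isLinear.Build _ _ _ _ _ (fl u)).
  rewrite -[LHS]/(g _) linear_sum; apply: eq_bigr => i _.
  by rewrite linearZ.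
rewrite [in RHS](coord_sum v) [in RHS](coord_sum w) suml; apply: eq_bigr => i _.
rewrite sumr scaler_sumr; apply: eq_bigr => j _.
by rewrite mxE scalerA.
Qed.

Lemma tens_ind V W (P : tens V W -> Prop) :
    P 0 -> (forall k s t, P s -> P t -> P (k *: s + t)) ->
  (forall v w, P (tmul v w)) -> forall t, P t.
Proof.
move=> P0 PD Pm t.
have -> : t = \sum_i \sum_j t i j *: tmul (vbasis {:V})`_i (vbasis {:W})`_j.
  rewrite [LHS]matrix_sum_delta; apply: eq_bigr => i _; apply: eq_bigr => j _.
  congr (_ *: _); apply/matrixP => a b; rewrite !mxE.
  have fr (X : vectType K) : free (vbasis {:X}) by exact/basis_free/vbasisP.
  rewrite !coord_free ?fr //.
  by rewrite [i == a]eq_sym [j == b]eq_sym; do 2!case: (_ == _); rewrite /= ?mulr1 ?mulr0.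
have PA s u : P s -> P u -> P (s + u) by rewrite -{2}[s]scale1r; apply: PD.
have PZ k s : P s -> P (k *: s) by rewrite -[k *: s]addr0 => ?; apply: PD.
by apply: big_ind => // i _; apply: big_ind => // j _; apply/PZ/Pm.
Qed.

Lemma tlift_ext V W U (f g : V -> W -> U) :
  (forall v w, f v w = g v w) -> tlift f =1 tlift g.
Proof. by move=> e t; apply: eq_bigr => i _; apply: eq_bigr => j _; rewrite e. Qed.

Lemma tlift_linear_fun V W U k (f g : V -> W -> U) t :
  tlift (fun v w => k *: f v w + g v w) t = k *: tlift f t + tlift g t.
Proof.
rewrite /tlift scaler_sumr -big_split; apply: eq_bigr => i _.
rewrite scaler_sumr -big_split; apply: eq_bigr => j _.
by rewrite scalerDr !scalerA mulrC.
Qed.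

Definition tmap V W V' W' (f : V -> V') (g : W -> W') :
    tens V W -> tens V' W' :=
  tlift (fun v w => tmul (f v) (g w)).

Definition tassoc U V W : tens (tens U V) W -> tens U (tens V W) :=
  tlift (fun t w => tlift (fun u v => tmul u (tmul v w)) t).

(* (a ⊗ b)(c ⊗ d) = ac ⊗ bd *)
Definition tmulalg (A B : falgType K) (s t : tens A B) : tens A B :=
  tlift (fun a b => tmap (fun c => a * c) (fun d => b * d) t) s.

Definition dual_space V := 'Hom(V, K^o).
HB.instance Definition _ V := Vector.on (dual_space V).

Definition dual_basis V (i : 'I_(\dim {:V})) : dual_space V :=
  linfun (coord (vbasis {:V}) i : V -> K^o).

Lemma dual_basisE V (i : 'I_(\dim {:V})) v :
  dual_basis i v = coord (vbasis {:V}) i v.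
Proof. by rewrite lfunE. Qed.

Lemma dual_sum V (phi : dual_space V) :
  phi = \sum_(i < \dim {:V}) phi (vbasis {:V})`_i *: dual_basis i.
Proof.
apply/lfunP => v; rewrite sum_lfunE {1}(coord_sum v) linear_sum.
apply: eq_bigr => i _.
by rewrite linearZ scale_lfunE dual_basisE /GRing.scale /= mulrC.
Qed.

(* The coproduct of A^* dual to the product of A; see [dual_comulE]. *)
Definition dual_comul (A : falgType K) (phi : dual_space A) :
    tens (dual_space A) (dual_space A) :=
  \sum_(i < \dim {:A}) \sum_(j < \dim {:A}) phi ((vbasis {:A})`_i * (vbasis {:A})`_j) *:
    tmul (dual_basis i) (dual_basis j).

Lemma dual_pair_bilinear V W (x : V) (y : W) :
  bilinear_for *:%R *:%R
    (fun (f : dual_space V) (g : dual_space W) => f x * g y : K^o).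
Proof.
split=> f k u v; rewrite /= add_lfunE scale_lfunE.
  by rewrite mulrDl scalerAl.
by rewrite mulrDr scalerAr.
Qed.

Lemma sum_bilinear_basis V W U (f : V -> W -> U) v w :
    bilinear_for *:%R *:%R f ->
  f v w = \sum_i \sum_j (coord (vbasis {:V}) i v * coord (vbasis {:W}) j w) *:
            f (vbasis {:V})`_i (vbasis {:W})`_j.
Proof.
move=> bf; rewrite -(tlift_tmul _ _ bf); apply: eq_bigr => i _.
by apply: eq_bigr => j _; rewrite mxE.
Qed.

Lemma dual_comulE (A : falgType K) (phi : dual_space A) x y :
  tlift (fun f g : dual_space A => f x * g y : K^o) (dual_comul phi) =
    phi (x * y).
Proof.
rewrite linear_sum (@sum_bilinear_basis _ _ _ (fun a b => phi (a * b))); last first.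
  by split=> a k b c; rewrite /= ?mulrDl ?mulrDr -?scalerAl -?scalerAr linearP.
apply: eq_bigr => i _; rewrite linear_sum; apply: eq_bigr => j _.
rewrite linearZ /= (tlift_tmul _ _ (dual_pair_bilinear x y)) !dual_basisE.
by rewrite /GRing.scale /= mulrC.
Qed.

(* v ⊗ φ is sent to h |-> <φ, h> v. *)
Definition hom_of_tens V W (t : tens V (dual_space W)) : 'Hom(W, V) :=
  tlift (fun v (phi : dual_space W) => linfun (fun w => phi w *: v)) t.
Lemma hom_of_tens_is_linear V W : linear (@hom_of_tens V W).
Proof. exact: tlift_is_linear. Qed.
HB.instance Definition _ V W := GRing.isLinear.Build K (tens V (dual_space W))
  'Hom(W, V) *:%R (@hom_of_tens V W) (@hom_of_tens_is_linear V W).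

Definition tens_of_hom V W (F : 'Hom(W, V)) : tens V (dual_space W) :=
  \sum_(i < \dim {:W}) tmul (F (vbasis {:W})`_i) (dual_basis i).

Lemma rank1_linear V W (v : V) (phi : dual_space W) :
  linear (fun w => phi w *: v).
Proof. by move=> k x y; rewrite linearP scalerDl scalerA. Qed.

Lemma rank1E V W (v : V) (phi : dual_space W) w :
  linfun (fun w => phi w *: v) w = phi w *: v.
Proof.
pose g : {linear W -> V} :=
  HB.pack (fun w => phi w *: v) (GRing.isLinear.Build _ _ _ _ _ (rank1_linear v phi)).
exact: (lfunE g).
Qed.

Lemma rank1_bilinear V W : bilinear_for *:%R *:%R
  (fun (v : V) (phi : dual_space W) => linfun (fun w => phi w *: v)).
Proof.
split=> u k x y; apply/lfunP => w;
  rewrite add_lfunE scale_lfunE !rank1E ?add_lfunE ?scale_lfunE.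
  by rewrite scalerDr !scalerA mulrC.
by rewrite scalerDl scalerA.
Qed.

Lemma hom_of_tmul V W (v : V) (phi : dual_space W) w :
  hom_of_tens (tmul v phi) w = phi w *: v.
Proof. by rewrite /hom_of_tens (tlift_tmul _ _ (@rank1_bilinear V W)) rank1E. Qed.

Lemma tens_of_hom_is_linear V W : linear (@tens_of_hom V W).
Proof.
move=> k F G; rewrite /tens_of_hom scaler_sumr -big_split; apply: eq_bigr => i _.
by rewrite add_lfunE scale_lfunE; exact: (tmul_bilinear V _).1.
Qed.
HB.instance Definition _ V W := GRing.isLinear.Build K 'Hom(W, V)
  (tens V (dual_space W)) *:%R (@tens_of_hom V W) (@tens_of_hom_is_linear V W).

Lemma tens_of_homK V W : cancel (@tens_of_hom V W) (@hom_of_tens V W).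
Proof.
move=> F; apply/lfunP => w; rewrite linear_sum sum_lfunE.
rewrite [in RHS](coord_sum w) linear_sum; apply: eq_bigr => i _.
by rewrite hom_of_tmul dual_basisE linearZ.
Qed.

Lemma hom_of_tensK V W : cancel (@hom_of_tens V W) (@tens_of_hom V W).
Proof.
elim/tens_ind => [|k s t es et|v phi]; first by rewrite !linear0.
  by rewrite 2!linearP -[in RHS]es -[in RHS]et.
have [_ tr] := tmul_bilinear V (dual_space W).
pose g : {linear dual_space W -> tens V (dual_space W)} :=
  HB.pack (tmul v) (GRing.isLinear.Build _ _ _ _ _ (tr v)).
rewrite /tens_of_hom [in RHS](dual_sum phi) -[RHS]/(g _) linear_sum; apply: eq_bigr => i _.
rewrite hom_of_tmul linearZ; apply/matrixP => a b.
by rewrite !mxE linearZ /= mulrA.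
Qed.

End Tensor.

Record hopfAlgebra (K : fieldType) := HopfAlgebra {
  hopf_alg :> falgType K;
  comul : {linear hopf_alg -> tens hopf_alg hopf_alg};
  counit : {linear hopf_alg -> K^o};
  antipode : {linear hopf_alg -> hopf_alg};
  comulA : forall h,
    tassoc (tmap comul id (comul h)) = tmap id comul (comul h);
  counitL : forall h, tlift (fun a b => counit a *: b) (comul h) = h;
  counitR : forall h, tlift (fun a b => counit b *: a) (comul h) = h;
  comul1 : comul 1 = tmul 1 1;
  comulM : forall g h, comul (g * h) = tmulalg (comul g) (comul h);
  counit1 : counit 1 = 1;
  counitM : forall g h, counit (g * h) = counit g * counit h;
  antipodeL : forall h,
    tlift (fun a b => antipode a * b) (comul h) = counit h *: 1;
  antipodeR : forall h,
    tlift (fun a b => a * antipode b) (comul h) = counit h *: 1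
}.

Arguments comul {K h0}.
Arguments counit {K h0}.
Arguments antipode {K h0}.

Record lmodule (K : fieldType) (A : falgType K) := LModule {
  module_space :> vectType K;
  act : A -> module_space -> module_space;
  act_bilinear : bilinear_for *:%R *:%R act;
  act1 : forall v, act 1 v = v;
  actM : forall a b v, act (a * b) v = act a (act b v)
}.

Arguments act {K A M} a v : rename.

(* The module structure [actU] on the subspace U makes it a submodule of N. *)
Definition is_submodule (K : fieldType) (A : falgType K) (N : lmodule A)
    (U : {vspace N}) (actU : A -> subvs_of U -> subvs_of U) : Prop :=
  (forall a x, x \in U -> act a x \in U) /\
  (forall a (u : subvs_of U), vsval (actU a u) = act a (vsval u)).

Arguments is_submodule {K A} N U actU.

Section HopfModules.
Variables (K : fieldType) (H : hopfAlgebra K).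

Section CounitModule.
Variable V : vectType K.

Definition counit_act (h : H) (v : V) : V := counit h *: v.

Lemma counit_act_bilinear : bilinear_for *:%R *:%R counit_act.
Proof.
split=> u k x y; rewrite /counit_act.
  by rewrite linearP scalerDl; congr (_ + _); exact/esym/scalerA.
by rewrite scalerDr scalerA mulrC -scalerA.
Qed.

Lemma counit_act1 v : counit_act 1 v = v.
Proof. by rewrite /counit_act counit1 scale1r. Qed.

Lemma counit_actM g h v : counit_act (g * h) v = counit_act g (counit_act h v).
Proof. by rewrite /counit_act counitM -scalerA. Qed.

Definition counit_module : lmodule H :=
  LModule counit_act_bilinear counit_act1 counit_actM.
End CounitModule.

(* h ▷ φ = <h, φ_(2)> φ_(1), for the coproduct of H^*. *)
Definition regular_act (h : H) (phi : dual_space H) : dual_space H :=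
  tlift (fun phi1 phi2 : dual_space H => phi2 h *: phi1) (dual_comul phi).

Lemma regular_actE h phi h' : regular_act h phi h' = phi (h' * h).
Proof.
rewrite -dual_comulE /regular_act /tlift sum_lfunE; apply: eq_bigr => i _.
rewrite sum_lfunE; apply: eq_bigr => j _.
by rewrite !scale_lfunE; congr (_ *: _); rewrite /GRing.scale /= mulrC.
Qed.

Lemma regular_act_bilinear : bilinear_for *:%R *:%R regular_act.
Proof.
split=> u k x y; apply/lfunP => h.
  by rewrite add_lfunE scale_lfunE !regular_actE mulrDr -scalerAr linearP.
by rewrite add_lfunE scale_lfunE !regular_actE add_lfunE scale_lfunE.
Qed.

Lemma regular_act1 phi : regular_act 1 phi = phi.
Proof. by apply/lfunP => h; rewrite regular_actE mulr1. Qed.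

Lemma regular_actM g h phi :
  regular_act (g * h) phi = regular_act g (regular_act h phi).
Proof. by apply/lfunP => x; rewrite !regular_actE mulrA. Qed.

Definition left_regular : lmodule H :=
  LModule regular_act_bilinear regular_act1 regular_actM.

Section TensorModule.
Variables M N : lmodule H.

(* For s = a ⊗ b and t = v ⊗ w this is (a ▷ v) ⊗ (b ▷ w). *)
Definition tens_act2 (s : tens H H) (t : tens M N) : tens M N :=
  tlift (fun a b => tmap (act a) (act b) t) s.

Definition tens_act (h : H) (t : tens M N) : tens M N :=
  tens_act2 (comul h) t.

Lemma tmulDl (V W : vectType K) (w : W) k (x y : V) :
  tmul (k *: x + y) w = k *: tmul x w + tmul y w.
Proof. exact: (tmul_bilinear V W).1. Qed.

Lemma tmulDr (V W : vectType K) (v : V) k (x y : W) :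
  tmul v (k *: x + y) = k *: tmul v x + tmul v y.
Proof. exact: (tmul_bilinear V W).2. Qed.

Lemma actDl (X : lmodule H) (v : X) k (a b : H) :
  act (k *: a + b) v = k *: act a v + act b v.
Proof. exact: (act_bilinear X).1. Qed.

Lemma actDr (X : lmodule H) (a : H) k (v w : X) :
  act a (k *: v + w) = k *: act a v + act a w.
Proof. exact: (act_bilinear X).2. Qed.

Lemma tens_act2_linearl t : linear (tens_act2^~ t).
Proof. exact: tlift_is_linear. Qed.

Lemma tens_act2_linearr s : linear (tens_act2 s).
Proof.
move=> k t u; rewrite /tens_act2 -tlift_linear_fun; apply: tlift_ext => a b.
by rewrite /tmap linearP.
Qed.

Lemma tens_act_bilinear : bilinear_for *:%R *:%R tens_act.
Proof.
split=> u k x y; rewrite /tens_act; last exact: tens_act2_linearr.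
by rewrite linearP; exact: tens_act2_linearl.
Qed.

Lemma tens_act2_tmul a b v w :
  tens_act2 (tmul a b) (tmul v w) = tmul (act a v) (act b w).
Proof.
rewrite /tens_act2 tlift_tmul /tmap.
  by rewrite tlift_tmul //; split=> u k x y; rewrite !actDr ?tmulDl ?tmulDr.
split=> u k x y; rewrite -tlift_linear_fun; apply: tlift_ext => v' w';
  by rewrite actDl ?tmulDl ?tmulDr.
Qed.

Lemma tmulalg_tmul (a b c d : H) :
  tmulalg (tmul a b) (tmul c d) = tmul (a * c) (b * d).
Proof.
rewrite /tmulalg tlift_tmul /tmap.
  rewrite tlift_tmul //; split=> u k x y;
  by rewrite mulrDr -scalerAr ?tmulDl ?tmulDr.
split=> u k x y; rewrite -tlift_linear_fun; apply: tlift_ext => v' w';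
  by rewrite mulrDl -scalerAl ?tmulDl ?tmulDr.
Qed.

Lemma tmulalg_linearl (t : tens H H) : linear (fun s : tens H H => tmulalg s t).
Proof. exact: tlift_is_linear. Qed.

Lemma tmulalg_linearr (s : tens H H) : linear (tmulalg s).
Proof.
move=> k t u; rewrite /tmulalg -tlift_linear_fun; apply: tlift_ext => a b.
by rewrite /tmap linearP.
Qed.

Lemma linear0P (X Y : lmodType K) (f : X -> Y) : linear f -> f 0 = 0.
Proof.
by move=> fl; have := fl (-1) 0 0; rewrite scaler0 addr0 scaleN1r addNr.
Qed.

Lemma tens_act2M s r t :
  tens_act2 (tmulalg s r) t = tens_act2 s (tens_act2 r t).
Proof.
elim/tens_ind: s => [|k s s' IH IH'|a b].
- by rewrite (linear0P (tmulalg_linearl r)) !(linear0P (tens_act2_linearl _)).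
- by rewrite tmulalg_linearl !tens_act2_linearl IH IH'.
elim/tens_ind: r => [|k r r' IH IH'|c d].
- rewrite (linear0P (tmulalg_linearr _)) !(linear0P (tens_act2_linearl _)).
  by rewrite (linear0P (tens_act2_linearr _)).
- by rewrite tmulalg_linearr !tens_act2_linearl IH IH' tens_act2_linearr.
elim/tens_ind: t => [|k t t' IH IH'|v w].
- by rewrite !(linear0P (tens_act2_linearr _)).
- by rewrite !tens_act2_linearr IH IH'.
by rewrite tmulalg_tmul !tens_act2_tmul !actM.
Qed.

Lemma tens_act1 t : tens_act 1 t = t.
Proof.
rewrite /tens_act comul1; elim/tens_ind: t => [|k t t' IH IH'|v w].
- exact: linear0P (tens_act2_linearr _).
- by rewrite tens_act2_linearr IH IH'.
by rewrite tens_act2_tmul !act1.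
Qed.

Lemma tens_actM g h t : tens_act (g * h) t = tens_act g (tens_act h t).
Proof. by rewrite /tens_act comulM tens_act2M. Qed.

Definition tensor_module : lmodule H :=
  LModule tens_act_bilinear tens_act1 tens_actM.
End TensorModule.

Section Coinduced.
(* The identity of an {aspace H} need not be that of H; L is a unital
   subalgebra of H under the further hypothesis 1 \in L. *)
Variables (L : {aspace H}) (V : lmodule (subvs_of L)).

(* F (l h) - l ▷ F(h), as a linear function of F *)
Definition hom_defect (l : subvs_of L) (h : H) (F : 'Hom(H, V)) : V :=
  F (vsval l * h) - act l (F h).

Definition hom_L : {vspace 'Hom(H, V)} :=
  (\bigcap_(l <- vbasis {:subvs_of L}) \bigcap_(h <- vbasis {:H})
     lker (linfun (hom_defect l h)))%VS.

Lemma hom_defect_is_linear l h : linear (hom_defect l h).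
Proof.
move=> k F G; rewrite /hom_defect !add_lfunE !scale_lfunE (act_bilinear V).2 /=.
by rewrite scalerBr opprD addrACA.
Qed.
HB.instance Definition _ l h := GRing.isLinear.Build K 'Hom(H, V) V *:%R
  (hom_defect l h) (hom_defect_is_linear l h).

Lemma hom_defect_bilinear F : bilinear_for *:%R *:%R (fun l h => hom_defect l h F).
Proof.
split=> u k x y; rewrite /hom_defect.
  rewrite linearP mulrDl -scalerAl linearP (act_bilinear V).1 /=.
  by rewrite scalerBr opprD addrACA.
rewrite mulrDr -scalerAr !linearP (act_bilinear V).2 /=.
by rewrite scalerBr opprD addrACA.
Qed.

(* hom_L = Hom_L(H, V): the conditions indexed by bases of L and H suffice. *)
Lemma mem_hom_L (F : 'Hom(H, V)) :
  F \in hom_L <-> forall l h, F (vsval l * h) = act l (F h).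
Proof.
have bigcapP (I : eqType) (r : seq I) (U : I -> {vspace 'Hom(H, V)}) :
    F \in (\bigcap_(x <- r) U x)%VS <-> forall x, x \in r -> F \in U x.
  elim: r => [|y r IH]; first by rewrite big_nil memvf.
  rewrite big_cons memv_cap; split=> [/andP[Fy /IH Fr] x|Fr].
    by rewrite inE => /predU1P[->|/Fr].
  by rewrite Fr ?mem_head //; apply/IH => x xr; rewrite Fr // inE xr orbT.
have kerP l h : F \in lker (linfun (hom_defect l h)) <-> hom_defect l h F = 0.
  by rewrite memv_ker lfunE; split=> /eqP.
split=> [/bigcapP FL l h|FL].
  apply/eqP; rewrite -subr_eq0 -[_ - _]/(hom_defect l h F).
  rewrite (sum_bilinear_basis _ _ (hom_defect_bilinear F)).
  apply/eqP/big1 => i _; apply: big1 => j _.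
  have/FL/bigcapP FLi : (vbasis {:subvs_of L})`_i \in vbasis {:subvs_of L}.
    by rewrite mem_nth ?size_tuple.
  have/FLi/kerP -> : (vbasis {:H})`_j \in vbasis {:H}.
    by rewrite mem_nth ?size_tuple.
  by rewrite scaler0.
apply/bigcapP => l _; apply/bigcapP => h _; apply/kerP.
by rewrite /hom_defect FL subrr.
Qed.

(* V^↑: the subspace of V ⊗ H^* identified with Hom_L(H, V). *)
Definition coind_space : {vspace tens V (dual_space H)} :=
  (linfun (@hom_of_tens K V H) @^-1: hom_L)%VS.

Lemma mem_coind_space (t : tens V (dual_space H)) :
  t \in coind_space <->
  forall l h, hom_of_tens t (vsval l * h) = act l (hom_of_tens t h).
Proof. by rewrite -memv_preim lfunE mem_hom_L. Qed.

(* (h ▷ F)(h') = F (h' h) *)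
Definition hom_act (h : H) (F : 'Hom(H, V)) : 'Hom(H, V) := (F \o amulr h)%VF.

Lemma hom_actE h F h' : hom_act h F h' = F (h' * h).
Proof. by rewrite comp_lfunE lfunE. Qed.

Lemma coind_act_subproof h (u : subvs_of coind_space) :
  tens_of_hom (hom_act h (hom_of_tens (vsval u))) \in coind_space.
Proof.
apply/mem_coind_space => l h'; rewrite tens_of_homK !hom_actE -mulrA.
exact: (mem_coind_space _).1 (subvsP u) l _.
Qed.

Definition coind_act h (u : subvs_of coind_space) : subvs_of coind_space :=
  Subvs (coind_act_subproof h u).

Lemma coind_actE h u h' :
  hom_of_tens (vsval (coind_act h u)) h' = hom_of_tens (vsval u) (h' * h).
Proof. by rewrite tens_of_homK hom_actE. Qed.

Lemma coind_ext (u v : subvs_of coind_space) :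
  (forall h, hom_of_tens (vsval u) h = hom_of_tens (vsval v) h) -> u = v.
Proof.
by move=> e; apply/val_inj/(can_inj (@hom_of_tensK K V H))/lfunP => h; exact: e.
Qed.

Lemma coind_act_bilinear : bilinear_for *:%R *:%R coind_act.
Proof.
have lin (t s : tens V (dual_space H)) k h :
  hom_of_tens (k *: t + s) h = k *: hom_of_tens t h + hom_of_tens s h.
  by rewrite linearP add_lfunE scale_lfunE.
split=> u k x y; apply: coind_ext => h;
  rewrite [vsval (_ *: coind_act _ _ + _)]linearP lin !coind_actE.
  by rewrite mulrDr -scalerAr linearP.
by rewrite [vsval (_ + _)]linearP lin.
Qed.

Lemma coind_act1 u : coind_act 1 u = u.
Proof. by apply: coind_ext => h; rewrite coind_actE mulr1. Qed.

Lemma coind_actM g h u : coind_act (g * h) u = coind_act g (coind_act h u).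
Proof. by apply: coind_ext => x; rewrite !coind_actE mulrA. Qed.

Definition coinduced_module : lmodule H :=
  LModule coind_act_bilinear coind_act1 coind_actM.
End Coinduced.
End HopfModules.

(* Main.v *)
Require Import Defs.
From HB Require Import structures.
From mathcomp Require Import all_boot all_algebra falgebra.
From mathcomp Require Import reals.
From mathcomp Require Import complex.
Import GRing.Theory.
Local Open Scope ring_scope.

(** Under the identification of V ⊗ H^* with Hom(H, V), the element
    h_(1) ⊗ h_(2) sends F to ε(h_(1)) F(- h_(2)), and the counit axiom
    collapses this to F(- h). *)

(** By [hom_of_tens_act], the tensor product action is right translation by h on all of Hom(H, V),
    the formula that also defines the coinduced action. Right translation commutes with left
    multiplication by L, so it preserves L-linearity; injectivity of [hom_of_tens] then identifies
    the two actions. *)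

Section CounitTensorRegular.
Variables (K : fieldType) (H : hopfAlgebra K) (V : vectType K).
Local Notation M := (counit_module H V).
Local Notation N := (left_regular H).

(** With an arbitrary [s] in place of [comul h], both sides are linear in [s] and in [t], so pure
    tensors suffice. *)
Lemma hom_of_tens_act2 (s : tens H H) (t : tens M N) (h' : H) :
  hom_of_tens (tens_act2 s t : tens V (dual_space H)) h' =
  hom_of_tens (t : tens V (dual_space H))
    (h' * tlift (fun a b : H => counit a *: b) s).
Proof.
elim/tens_ind: s => [|k s s' IH IH'|a b].
- by rewrite (linear0P (tens_act2_linearl t)) !linear0 mulr0 linear0 lfunE.
- rewrite tens_act2_linearl !linearP add_lfunE scale_lfunE IH IH'.
  by rewrite mulrDr -scalerAr linearP.
rewrite tlift_tmul; last first.
  split=> u k x y /=; last by rewrite scalerDr !scalerA mulrC.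
  by rewrite linearP scalerDl /= -scalerA.
elim/tens_ind: t => [|k t t' IH IH'|v phi].
- by rewrite (linear0P (tens_act2_linearr _)) !linear0 !lfunE.
- by rewrite tens_act2_linearr !linearP !add_lfunE !scale_lfunE IH IH'.
rewrite tens_act2_tmul !hom_of_tmul /= regular_actE /counit_act.
(* Both sides equal ε(a) φ(h' b) v. *)
by rewrite -scalerAr [phi (_ *: _)]linearZ scalerA mulrC.
Qed.

Lemma hom_of_tens_act (h : H) (t : tensor_module M N) (h' : H) :
  hom_of_tens (act h t : tens V (dual_space H)) h' =
  hom_of_tens (t : tens V (dual_space H)) (h' * h).
Proof. by rewrite [act h t]/(tens_act2 (comul h) t) hom_of_tens_act2 counitL. Qed.

End CounitTensorRegular.

Theorem proposition2 (R : realType) (K : fieldType)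
    (hK : K = (R : fieldType) \/ K = (R[i] : fieldType))
    (H : hopfAlgebra K) (L : {aspace H}) (hL : 1 \in L)
    (V : lmodule (subvs_of L)) :
  is_submodule (tensor_module (counit_module H V) (left_regular H))
    (coind_space V) (act (M := coinduced_module V)).
Proof.
split=> [h t /mem_coind_space tL|h u].
  apply/mem_coind_space => l h'.
  by rewrite !hom_of_tens_act -mulrA tL.
apply: (can_inj (@hom_of_tensK K V H)); apply/lfunP => h'.
by rewrite hom_of_tens_act coind_actE.
Qed.
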